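(* Let $U\subseteq\Theta^\circ$ be open and let the kernel $f$ satisfy a parameter PDE on $U$ for a parameter differential operator $\mathcal L_\theta$ on $U$ that is non-trivial on an open ball $B$ with $\bar B\subset U$. Let $G_*$ be a Borel probability measure on $\Theta$ admitting a density $g_*$ with respect to the Lebesgue measure on $\Theta$ such that $g_*\ge m$ Lebesgue-almost everywhere on $B$, for some $m>0$. Then there exists a Borel probability measure $G$ on $\Theta$ with $G\neq G_*$ and $p_G=p_{G_*}$ $\lambda$-almost everywhere.
   Context: Standing setting. The sample space $\mathcal X$ is a Borel subset of $\mathbb R^{d_1}$ with a $\sigma$-finite Borel measure $\lambda$ (understood to be Lebesgue measure for continuous kernels and counting measure for discrete ones). The parameter space $\Theta\subset\mathbb R^{d_2}$ is compact and equal to the closure of its interior $\Theta^\circ$, which is non-empty; $\Theta$ carries the restriction of Lebesgue measure. A kernel is a jointly measurable function $f:\mathcal X\times\Theta\to[0,\infty)$, written $f(x\mid\theta)$, with $\int_{\mathcal X}f(x\mid\theta)\,\lambda(dx)=1$ for every $\theta\in\Theta$. For a Borel probability measure $G$ on $\Theta$, $p_G(x):=\int_\Theta f(x\mid\theta)\,G(d\theta)$. For a multi-index $\alpha\in\mathbb N_0^{d_2}$, $|\alpha|=\alpha_1+\cdots+\alpha_{d_2}$ and $\partial_\theta^\alpha=\partial^{|\alpha|}/\partial\theta_1^{\alpha_1}\cdots\partial\theta_{d_2}^{\alpha_{d_2}}$ (the identity when $|\alpha|=0$). Parameter differential operator. For $U\subseteq\Theta^\circ$ open and $r\in\mathbb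 N_0$, a parameter differential operator on $U$ of order $r$ is a map $\mathcal L_\theta$ acting on functions $w\in C^r(U)$ by $\mathcal L_\theta w=\sum_{|\alpha|\le r}c_\alpha(\theta)\,\partial_\theta^\alpha w$, $\theta\in U$, with coefficients $c_\alpha\in C^{|\alpha|}(U)$. It is non-trivial on a set $A\subseteq U$ if $c_\alpha$ is not identically zero on $A$ for at least one $\alpha$ with $|\alpha|\ge 1$. Parameter PDE. The kernel $f$ satisfies a parameter PDE on $U$ (for $\mathcal L_\theta$) if, for $\lambda$-almost every $x\in\mathcal X$, the function $\theta\mapsto f(x\mid\theta)$ belongs to $C^r(U)$ and $\mathcal L_\theta f(x\mid\theta)=0$ for every $\theta\in U$. *)

(* Defs.v *)
From HB Require Import structures.
From mathcomp Require Import all_boot all_order all_algebra.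
From mathcomp Require Import all_classical all_reals all_analysis.
From mathcomp Require Import measurable_realfun.

Set Implicit Arguments.
Unset Strict Implicit.
Unset Printing Implicit Defensive.

Import Order.TTheory GRing.Theory Num.Theory.
Import numFieldTopology.Exports numFieldNormedType.Exports.

Local Open Scope classical_set_scope.
Local Open Scope ring_scope.

Definition rV_borel_display : measure_display. Proof. exact: default_measure_display. Qed.

Section borel_rV.
Context {R : realType} {d : nat}.

(* Row vectors carry their Borel sigma-algebra, generated by the open sets of
   the product topology (the topology of 'rV[R]_d in the library). *)
HB.instance Definition _ := @isMeasurable.Build rV_borel_display 'rV[R]_d
  <<s (@open 'rV[R]_d) >> (@sigma_algebra0 _ setT _) (@sigma_algebraC 'rV[R]_d _)
  (@sigma_algebra_bigcup _ setT _).
End borel_rV.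

Section borel_rV_theory.
Context {R : realType} {d : nat}.

Lemma rV_open_measurable (A : set 'rV[R]_d) : open A -> measurable A.
Proof. by move=> oA; exact: sub_sigma_algebra. Qed.

Lemma measurable_coord (i : 'I_d) :
  measurable_fun [set: 'rV[R]_d] (fun v => v ord0 i).
Proof.
apply: (measurability _ (RGenOpens.measurableE R)).
move=> _ [_ [a [b ->] <-]]; rewrite setTI; apply: rV_open_measurable.
apply: open_comp; last exact: interval_open.
by move=> v _; exact: coord_continuous.
Qed.

Lemma measurable_fun_rV d' (T : measurableType d') (f : T -> 'rV[R]_d) :
  (forall i, measurable_fun [set: T] (fun t => f t ord0 i)) ->
  measurable_fun [set: T] f.
Proof.
move=> mf; apply: (@measurability _ _ _ _ setT f (@open 'rV[R]_d)) => //.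
move=> _ [A oA <-]; rewrite setTI.
pose q_ (p : 'rV[rat]_d * nat) : 'rV[R]_d := map_mx ratr p.1.
pose D := [set p : 'rV[rat]_d * nat | ball (q_ p) p.2.+1%:R^-1 `<=` A].
have -> : A = \bigcup_(p in D) ball (q_ p) p.2.+1%:R^-1.
  apply/seteqP; split=> [v Av|v [p Dp]]; last exact: Dp.
  have /nbhs_ballP[e /= e0 eA] : nbhs v A by apply: open_nbhs_nbhs; split.
  have [k ke] : exists k : nat, k.+1%:R^-1 < e / 2.
    have := near_infty_natSinv_lt (PosNum (divr_gt0 e0 (ltr0n R 2))) => -[k _ /(_ k)].
    by move=> H; exists k; apply: H => /=.
  have hq i : exists q : rat, `|v ord0 i - ratr q| < k.+1%:R^-1.
    have : (v ord0 i - k.+1%:R^-1 : R) < v ord0 i + k.+1%:R^-1.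
      by rewrite ltrBlDr -addrA ltrDl addr_gt0// invr_gt0.
    move=> /rat_in_itvoo[q]; rewrite in_itv/= => /andP[q1 q2].
    by exists q; rewrite ltr_distlC q1 q2.
  pose w := \row_i sval (cid (hq i)).
  have wv : ball (q_ (w, k)) k.+1%:R^-1 v.
    split => [|i j]; first by rewrite invr_gt0.
    by rewrite ord1 /ball/= /q_ !mxE/= distrC; case: cid.
  exists (w, k) => // u /= wu; apply: eA.
  have := ball_triangle (ball_sym wv) wu; apply: le_ball.
  by rewrite /= [leRHS](splitr e) lerD// ltW.
rewrite preimage_bigcup; rewrite bigcup_mkcond.
apply: countable_bigcupT_measurable => [|p]; first exact: countableP.
case: ifPn => // _.
have -> : f @^-1` ball (q_ p) p.2.+1%:R^-1 =
    \bigcap_(i in [set: 'I_d]) (fun t => f t ord0 i) @^-1`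
       ball (q_ p ord0 i) p.2.+1%:R^-1.
  apply/seteqP; split=> [t [_ H] i _|t H]; first exact: H.
  by split => [|i j]; [rewrite invr_gt0|rewrite ord1; exact: H].
apply: fin_bigcap_measurable => // i _.
rewrite -[X in measurable X]setTI; apply: mf => //.
by apply: open_measurable; exact: ball_open.
Qed.

End borel_rV_theory.

Section rV_cons.
Context {R : realType} {d : nat}.

Definition rV_cons (p : R * 'rV[R]_d) : 'rV[R]_d.+1 :=
  row_mx (p.1%:M : 'rV[R]_1) p.2.

Lemma rV_consE0 p : rV_cons p ord0 ord0 = p.1.
Proof.
have -> : ord0 = @lshift 1 d ord0 by exact: val_inj.
by rewrite (@row_mxEl _ _ 1 d) mxE.
Qed.

Lemma rV_consES p i : rV_cons p ord0 (lift ord0 i) = p.2 ord0 i.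
Proof.
have -> : lift ord0 i = @rshift 1 d i by exact: val_inj.
by rewrite (@row_mxEr _ _ 1 d).
Qed.

Lemma measurable_rV_cons : measurable_fun setT rV_cons.
Proof.
apply: measurable_fun_rV => i.
case: (unliftP ord0 i) => [j|] ->; last first.
  by under eq_fun do rewrite rV_consE0; exact: measurable_fst.
under eq_fun do rewrite rV_consES.
exact: measurableT_comp (measurable_coord j) (@measurable_snd _ _ _ _).
Qed.
End rV_cons.

Section lebesgue_rV.
Context {R : realType}.

Section step.
Context {d : nat} (mu : {sigma_finite_measure set 'rV[R]_d -> \bar R}).

Definition rV_lebesgue_step : set 'rV[R]_d.+1 -> \bar R :=
  pushforward (@lebesgue_measure R \x mu)%E rV_cons.

Let step0 : rV_lebesgue_step set0 = 0%E.
Proof. by rewrite /rV_lebesgue_step /pushforward preimage_set0 measure0. Qed.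

Let step_ge0 A : (0 <= rV_lebesgue_step A)%E.
Proof. by rewrite /rV_lebesgue_step /pushforward measure_ge0. Qed.

Let mpre (A : set 'rV[R]_d.+1) : measurable A -> measurable (rV_cons @^-1` A).
Proof. by move=> mA; rewrite -[X in measurable X]setTI; exact: measurable_rV_cons. Qed.

Let step_sigma_additive : semi_sigma_additive rV_lebesgue_step.
Proof.
move=> F mF tF mUF; rewrite /rV_lebesgue_step /pushforward preimage_bigcup.
apply: measure_semi_sigma_additive => [n||]; first exact: mpre.
- apply/trivIsetP => /= i j _ _ ij; rewrite -preimage_setI.
  by move/trivIsetP : tF => /(_ _ _ _ _ ij) ->//; rewrite preimage_set0.
- by rewrite -preimage_bigcup; exact: mpre.
Qed.

HB.instance Definition _ := isMeasure.Build _ _ _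
  rV_lebesgue_step step0 step_ge0 step_sigma_additive.

Let step_sigma_finite : sigma_finite setT rV_lebesgue_step.
Proof.
pose uncons (v : 'rV[R]_d.+1) : R * 'rV[R]_d :=
  (v ord0 ord0, \row_i v ord0 (lift ord0 i)).
have consK : cancel rV_cons uncons.
  case=> x v; rewrite /uncons rV_consE0; congr pair.
  by apply/rowP => i; rewrite mxE rV_consES.
have unconsK : cancel uncons rV_cons.
  move=> v; apply/rowP => i; case: (unliftP ord0 i) => [j|] ->.
    by rewrite rV_consES mxE.
  by rewrite rV_consE0.
have munc : measurable_fun setT uncons.
  apply: measurable_fun_pair => /=; first exact: measurable_coord.
  apply: measurable_fun_rV => i.
  by under eq_fun do rewrite mxE; exact: measurable_coord.
have [F FT Ffin] : sigma_finite setT (@lebesgue_measure R \x mu)%E.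
  have /sigma_finiteP[F [TF ndF Foo]] := sigma_finiteT (@lebesgue_measure R).
  have /sigma_finiteP[G [TG ndG Goo]] := sigma_finiteT mu.
  exists (fun n => F n `*` G n).
    rewrite -setXTT TF TG predeqE => -[x y]; split.
      move=> [/= [n _ Fnx] [k _ Gky]]; exists (maxn n k) => //; split.
      - by move: x Fnx; exact/subsetPset/ndF/leq_maxl.
      - by move: y Gky; exact/subsetPset/ndG/leq_maxr.
    by move=> [n _ []/= ? ?]; split; exists n.
  move=> k; have [? ?] := Foo k; have [? ?] := Goo k.
  split; first exact: measurableX.
  by rewrite product_measure1E// lte_mul_pinfty// ge0_fin_numE.
exists (fun n => uncons @^-1` F n).
  by rewrite -preimage_bigcup -FT.
move=> n; have [mF Foo] := Ffin n; split.
  by rewrite -[X in measurable X]setTI; exact: munc.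
rewrite /rV_lebesgue_step /pushforward -comp_preimage.
by rewrite (_ : uncons \o rV_cons = id)//; exact/funext.
Qed.

HB.instance Definition _ := Measure_isSigmaFinite.Build _ _ _
  rV_lebesgue_step step_sigma_finite.

End step.

(* Lebesgue measure on R^d: the d-fold product of one-dimensional Lebesgue
   measure, transported along R * R^d -> R^(1 + d). *)
Fixpoint rV_lebesgue (d : nat) : {sigma_finite_measure set 'rV[R]_d -> \bar R} :=
  match d with
  | 0 => dirac (0 : 'rV[R]_0)
  | d'.+1 => rV_lebesgue_step (rV_lebesgue d')
  end.

Lemma rV_lebesgue_box d (a b : 'I_d -> R) : (forall i, a i <= b i) ->
  rV_lebesgue d [set v | forall i, a i <= v ord0 i <= b i] =
  (\prod_(i < d) (b i - a i))%:E.
Proof.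
elim: d a b => [|d IH] a b ab.
  rewrite big_ord0 /= diracE mem_set//=; by case.
rewrite big_ord_recl EFinM -IH//= /rV_lebesgue_step /pushforward.
have -> : rV_cons @^-1` [set v : 'rV[R]_d.+1 | forall i, a i <= v ord0 i <= b i]
  = `[a ord0, b ord0]%classic `*`
    [set v : 'rV[R]_d | forall i, a (lift ord0 i) <= v ord0 i <= b (lift ord0 i)].
  apply/seteqP; split => [[x v] H|[x v] [/= + H] i].
    split => [|i]; first by have := H ord0; rewrite rV_consE0/= in_itv.
    by have := H (lift ord0 i); rewrite rV_consES.
  rewrite in_itv/= => xab; case: (unliftP ord0 i) => [j|] ->.
    by rewrite rV_consES; exact: H.
  by rewrite rV_consE0.
rewrite product_measure1E//=.
- congr (_ * _)%E; rewrite lebesgue_measure_itv/= lte_fin.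
  have := ab ord0; rewrite le_eqVlt => /predU1P[->|->]; last by rewrite EFinB.
  by rewrite ltxx subrr.
- rewrite (_ : mkset _ = \bigcap_(i in [set: 'I_d]) (fun v : 'rV[R]_d => v ord0 i) @^-1`
      `[a (lift ord0 i), b (lift ord0 i)]%classic); last first.
    apply/seteqP; split=> [v H i _|v H i]; first by rewrite /= in_itv/=; exact: H.
    by have := H i I; rewrite /= in_itv.
  apply: fin_bigcap_measurable => // i _; rewrite -[X in measurable X]setTI.
  by apply: measurable_coord.
Qed.

End lebesgue_rV.

Section differential_operators.
Context {R : realType} {d : nat}.
Implicit Types (U A : set 'rV[R]_d) (w : 'rV[R]_d -> R).

Definition partial (i : 'I_d) w : 'rV[R]_d -> R := fun t => 'D_('e_i) w t.

(* Membership in C^k(U) for open U; only the values of w on U matter. *)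
Fixpoint class_C (k : nat) U w : Prop :=
  (forall t, U t -> {for t, continuous w}) /\
  match k with
  | 0 => True
  | k'.+1 => forall i : 'I_d, (forall t, U t -> derivable w t 'e_i) /\
                              class_C k' U (partial i w)
  end.

(* Multi-indices alpha in N^d with |alpha| <= r; the bound on each component
   only serves to make the type finite. *)
Definition multi_index (r : nat) :=
  {a : {ffun 'I_d -> 'I_r.+1} | (\sum_i a i <= r)%N}.

Definition mi_deg r (a : multi_index r) : nat := (\sum_i val a i)%N.

Definition mi_partial r (a : multi_index r) w : 'rV[R]_d -> R :=
  foldr (fun i v => iter (val a i) (partial i) v) w (enum 'I_d).

Record param_diff_op U (r : nat) := ParamDiffOp {
  pdo_coef : multi_index r -> 'rV[R]_d -> R ;
  pdo_coefC : forall a, class_C (mi_deg a) U (pdo_coef a) }.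

Definition pdo_apply U r (L : param_diff_op U r) w : 'rV[R]_d -> R :=
  fun t => \sum_(a : multi_index r) pdo_coef L a t * mi_partial a w t.

Definition pdo_nontrivial U r (L : param_diff_op U r) A : Prop :=
  exists a : multi_index r, (0 < mi_deg a)%N /\
    exists t, A t /\ pdo_coef L a t != 0.

(* Euclidean balls; the library's [ball] on row vectors is that of the sup
   norm. *)
Definition euclidean_ball (c : 'rV[R]_d) (e : R) : set 'rV[R]_d :=
  [set t | Num.sqrt (\sum_i (t ord0 i - c ord0 i) ^+ 2) < e].

End differential_operators.
Arguments multi_index : clear implicits.

Section kernels.
Context {R : realType} {d1 d2 : nat}.
Implicit Types (X : set 'rV[R]_d1) (Theta U : set 'rV[R]_d2).
Implicit Types (lam : {sigma_finite_measure set 'rV[R]_d1 -> \bar R}).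
Implicit Types (f : 'rV[R]_d1 -> 'rV[R]_d2 -> R).

Definition parameter_space Theta : Prop :=
  [/\ compact Theta, closure Theta° = Theta & Theta° !=set0].

(* A measure on the Borel set X is represented by a measure on the ambient
   space of which only the restriction to X is used, and f x t is only
   meaningful for x in X and t in Theta. *)
Definition is_kernel X lam Theta f : Prop :=
  [/\ measurable_fun (X `*` Theta) (fun p => f p.1 p.2),
      forall x t, X x -> Theta t -> 0 <= f x t &
      forall t, Theta t -> (\int[lam]_(x in X) (f x t)%:E = 1)%E].

Definition satisfies_param_pde X lam f U r (L : param_diff_op U r) : Prop :=
  {ae lam, forall x, X x ->
     class_C r U (f x) /\ forall t, U t -> pdo_apply L (f x) t = 0}.

Definition mixture Theta f (G : probability 'rV[R]_d2 R) : 'rV[R]_d1 -> \bar R :=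
  fun x => (\int[G]_(t in Theta) (f x t)%:E)%E.

Definition has_density Theta (G : probability 'rV[R]_d2 R) (g : 'rV[R]_d2 -> R)
    : Prop :=
  [/\ measurable_fun Theta g, forall t, Theta t -> 0 <= g t &
      forall A, measurable A -> A `<=` Theta ->
        G A = (\int[rV_lebesgue d2]_(t in A) (g t)%:E)%E].

End kernels.

(* Main.v *)
Require Import Defs.
From HB Require Import structures.
From mathcomp Require Import all_boot all_order all_algebra.
From mathcomp Require Import all_classical all_reals all_analysis.

From mathcomp Require Import measurable_realfun ring lra.

(** The idea is to move the mixing density by a function that no kernel
    [f x] can detect.  If [phi] is a test function supported in the ball and
    [h] is the formal adjoint of the operator applied to [phi], then
    integration by parts gives, for every solution [u] of the equation,
    << int u h = int (L u) phi = 0 >>;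
    in particular [h] is orthogonal to [f x] for almost every [x].  As [h] is
    bounded and supported in the ball, where the density [gs] is at least [m],
    a multiple of [h] with values in [-m, m] can be added to [gs] without
    losing positivity.  The result is a measure with the same mixture as the
    given one.

    The new measure has mass 1 because, by Tonelli and the normalisation of
    the kernel, a finite measure on the parameter space has the mass of its
    mixture ([integral_kernel_integral]).

    It remains to choose [phi] such that [h] is not zero almost everywhere.
    If a coefficient of the multi-index [a] does not vanish at [t0], the
    operator applied to the monomial [(t - t0)^a] takes at [t0] the value of
    this coefficient times [a!]; so it keeps a strict sign near [t0]
    ([pdo_apply_monomial_neq0]).  A nonnegative bump [phi] around [t0] then
    makes [int (L w) phi] non-zero for [w] this monomial, and this integral is
    [int w h].  This is [exists_pde_annihilator].

    Mixed derivatives are treated as words of partial derivatives, and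
    integration by parts moves one letter at a time
    ([integral_by_parts_word]).  Its analytic core is that the integral of a
    partial derivative of a compactly supported function vanishes
    ([integral_partial_eq0]): by Fubini along the product structure of the
    Lebesgue measure this is the fundamental theorem of calculus in one
    variable.  The measure-theoretic half is [exists_perturbed_measure]. *)

Set Implicit Arguments.
Unset Strict Implicit.
Unset Printing Implicit Defensive.

Import Order.TTheory GRing.Theory Num.Theory.
Import numFieldTopology.Exports numFieldNormedType.Exports.

Local Open Scope classical_set_scope.
Local Open Scope ring_scope.

(** * Calculus of functions of class [C^k] *)

Section class_C_theory.
Context {R : realType} {d : nat}.
Implicit Types (U V : set 'rV[R]_d) (u v w : 'rV[R]_d -> R).

Lemma class_C_continuous k U w t : class_C k U w -> U t -> {for t, continuous w}.
Proof. by case: k => [|k] [+ _]; exact. Qed.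

Lemma class_C_derivable k U w i t : class_C k.+1 U w -> U t -> derivable w t 'e_i.
Proof. by move=> [_ /(_ i)[+ _]]; exact. Qed.

Arguments class_C_derivable {k U w} i {t}.

Lemma class_C_partial k U w i : class_C k.+1 U w -> class_C k U (partial i w).
Proof. by move=> [_ /(_ i)[_]]. Qed.

Lemma class_CS k U w : class_C k.+1 U w -> class_C k U w.
Proof.
elim: k w => [|k IH] w Cw; first by case: Cw.
split=> [t Ut|i]; first exact: class_C_continuous Cw Ut.
split=> [t Ut|]; first exact: class_C_derivable Cw Ut.
exact/IH/class_C_partial.
Qed.

Lemma class_C_le k l U w : (k <= l)%N -> class_C l U w -> class_C k U w.
Proof.
move=> /subnK <-; elim: (l - k)%N => [//|n IH]; rewrite addSn => /class_CS.
exact: IH.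
Qed.

Lemma class_C_subset k U V w : U `<=` V -> class_C k V w -> class_C k U w.
Proof.
move=> UV; elim: k w => [|k IH] w [cw Cw]; (split; first by move=> t /UV; exact: cw) => // i.
have [dw Cdw] := Cw i; split=> [t Ut|]; first exact/dw/UV.
exact: IH.
Qed.

Lemma class_C_setU k U V w :
  class_C k U w -> class_C k V w -> class_C k (U `|` V) w.
Proof.
elim: k w => [|k IH] w CU CV; (split;
  first by move=> t [/(class_C_continuous CU)|/(class_C_continuous CV)]) => // i.
split=> [t|]; first by case=> [/(class_C_derivable i CU)|/(class_C_derivable i CV)].
by apply: IH; apply: class_C_partial.
Qed.

Lemma near_eq_on_open U u v t : open U -> {in U, u =1 v} -> U t ->
  \forall x \near t, u x = v x.
Proof.
move=> oU uv Ut; have := open_nbhs_nbhs (conj oU Ut).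
by apply: filterS => x Ux; apply: uv; rewrite inE.
Qed.

Lemma partial_eq U i u v : open U -> {in U, u =1 v} ->
  {in U, partial i u =1 partial i v}.
Proof.
move=> oU uv t /[!inE] Ut; apply: near_eq_derive.
exact: near_eq_on_open Ut.
Qed.

Lemma continuous_eq_on_open U u v t : open U -> {in U, u =1 v} -> U t ->
  {for t, continuous u} -> {for t, continuous v}.
Proof.
move=> oU uv Ut cu; have uv_near : {near t, u =1 v} by exact: near_eq_on_open Ut.
by rewrite /prop_for/continuous_at -uv ?inE//; exact: cvg_trans (near_eq_cvg uv_near) cu.
Qed.

Lemma class_C_eq k U u v : open U -> {in U, u =1 v} ->
  class_C k U u -> class_C k U v.
Proof.
move=> oU; elim: k u v => [|k IH] u v uv Cu; (split; first by move=> t Ut;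
  exact: continuous_eq_on_open uv Ut (class_C_continuous Cu Ut)) => // i.
split=> [t Ut|].
  have := class_C_derivable i Cu Ut; apply: near_eq_derivable.
  exact: near_eq_on_open Ut.
by apply: (IH (partial i u)); [exact: partial_eq|exact: class_C_partial].
Qed.

Lemma partial_cst i (a : R) : partial i (fun=> a) = (fun=> 0 : R) :> ('rV[R]_d -> R).
Proof. by apply/funext => t; exact: derive_cst. Qed.

Lemma class_C_cst k U (a : R) : class_C k U (fun=> a).
Proof.
elim: k a => [|k IH] a; (split; first by move=> t _; exact: cst_continuous) => // i.
split=> [t _|]; first exact: derivable_cst.
by rewrite partial_cst.
Qed.

Lemma class_CD k U u v : open U -> class_C k U u -> class_C k U v ->
  class_C k U (fun t => u t + v t).
Proof.
move=> oU; elim: k u v => [|k IH] u v Cu Cv; (split; first by move=> t Ut;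
  exact: cvgD (class_C_continuous Cu Ut) (class_C_continuous Cv Ut)) => // i.
have du t := class_C_derivable i (t := t) Cu.
  have dv t := class_C_derivable i (t := t) Cv.
  split=> [t Ut|]; first exact: derivableD (du _ Ut) (dv _ Ut).
  apply: (@class_C_eq _ _ (fun t => partial i u t + partial i v t)) => //.
    by move=> t /[!inE] Ut; rewrite /partial -deriveD//; [exact: du|exact: dv].
  by apply: IH; exact: class_C_partial.
Qed.

Lemma partialM i u v t : derivable u t 'e_i -> derivable v t 'e_i ->
  partial i (fun t => u t * v t) t = u t * partial i v t + v t * partial i u t.
Proof. by move=> du dv; exact: (deriveM du dv). Qed.

Lemma class_CM k U u v : open U -> class_C k U u -> class_C k U v ->
  class_C k U (fun t => u t * v t).
Proof.
move=> oU; elim: k u v => [|k IH] u v Cu Cv; (split; first by move=> t Ut;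
  exact: cvgM (class_C_continuous Cu Ut) (class_C_continuous Cv Ut)) => // i.
have du t := class_C_derivable i (t := t) Cu.
  have dv t := class_C_derivable i (t := t) Cv.
  split=> [t Ut|]; first exact: derivableM (du _ Ut) (dv _ Ut).
  apply: (@class_C_eq _ _ (fun t => u t * partial i v t + v t * partial i u t)) => //.
    by move=> t /[!inE] Ut; rewrite partialM//; [exact: du|exact: dv].
  have [Cu' Cv'] := (class_CS Cu, class_CS Cv).
  apply: class_CD => //.
    exact: IH Cu' (class_C_partial i Cv).
  exact: IH Cv' (class_C_partial i Cu).
Qed.

Lemma class_CZ k U (a : R) u : open U -> class_C k U u ->
  class_C k U (fun t => a * u t).
Proof. by move=> oU; apply: class_CM => //; exact: class_C_cst. Qed.

Lemma class_C_sum k U (I : Type) (s : seq I) (F : I -> 'rV[R]_d -> R) :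
  open U -> (forall j, class_C k U (F j)) ->
  class_C k U (fun t => \sum_(j <- s) F j t).
Proof.
move=> oU CF; elim: s => [|j s IH].
  by under eq_fun do rewrite big_nil; exact: class_C_cst.
by under eq_fun do rewrite big_cons; exact: class_CD.
Qed.

Lemma class_C_prod k U (I : Type) (s : seq I) (F : I -> 'rV[R]_d -> R) :
  open U -> (forall j, class_C k U (F j)) ->
  class_C k U (fun t => \prod_(j <- s) F j t).
Proof.
move=> oU CF; elim: s => [|j s IH].
  by under eq_fun do rewrite big_nil; exact: class_C_cst.
by under eq_fun do rewrite big_cons; exact: class_CM.
Qed.

Lemma partial_vanish (K : set 'rV[R]_d) i w : closed K ->
  (forall t, ~ K t -> w t = 0) -> forall t, ~ K t -> partial i w t = 0.
Proof.
move=> cK w0 t nKt; rewrite (@partial_eq (~` K) i w (fun=> 0)) ?inE//.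
- by rewrite partial_cst.
- exact: closed_openC.
- by move=> x /[!inE] /w0.
Qed.

(** A function of class [C^k] on [U] only, multiplied by a cutoff supported in
    a closed [K] inside [U], is of class [C^k] everywhere: whatever values
    the function has outside [U], the product is zero on the open complement
    of [K], and [U] and this complement cover the space. *)
Lemma class_C_mul_cutoff k U (K : set 'rV[R]_d) u phi :
  open U -> closed K -> K `<=` U -> (forall t, ~ K t -> phi t = 0) ->
  class_C k U u -> class_C k setT phi -> class_C k setT (fun t => u t * phi t).
Proof.
move=> oU cK KU phi0 Cu Cphi.
have -> : [set: 'rV[R]_d] = U `|` ~` K.
  apply/esym/seteqP; split=> // t _.
  by have [/KU|] := pselect (K t); [left|right].
apply: class_C_setU.
  by apply: class_CM => //; apply: class_C_subset Cphi.
apply: (@class_C_eq _ _ (fun=> 0)); last exact: class_C_cst.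
  exact: closed_openC.
by move=> t /[!inE] /phi0 ->; rewrite mulr0.
Qed.

Definition partials (s : seq 'I_d) w := foldr (@partial R d) w s.

Lemma partials_cat s1 s2 w : partials (s1 ++ s2) w = partials s1 (partials s2 w).
Proof. exact: foldr_cat. Qed.

Lemma partials_rcons s i w : partials (rcons s i) w = partials s (partial i w).
Proof. by rewrite -cats1 partials_cat. Qed.

Lemma class_C_partials k U s w :
  class_C (k + size s) U w -> class_C k U (partials s w).
Proof.
elim: s k w => [|i s IH] k w; first by rewrite addn0.
by rewrite /= addnS -addSn => Cw; apply/class_C_partial/IH.
Qed.

Lemma partials_vanish (K : set 'rV[R]_d) s w : closed K ->
  (forall t, ~ K t -> w t = 0) -> forall t, ~ K t -> partials s w t = 0.
Proof. by move=> cK w0; elim: s => //= i s IH; exact: partial_vanish. Qed.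

(** The letters come in the order in which [mi_partial] composes the partial
    derivatives, so that [mi_partialE] is a mere unfolding. *)
Definition mi_word r (a : multi_index d r) : seq 'I_d :=
  flatten [seq nseq (val a i) i | i <- enum 'I_d].

Lemma size_mi_word r (a : multi_index d r) : size (mi_word a) = mi_deg a.
Proof.
rewrite size_flatten /shape -map_comp sumnE big_map /mi_deg big_enum /=.
by apply: eq_bigr => i _; rewrite size_nseq.
Qed.

Lemma mi_partialE r (a : multi_index d r) w : mi_partial a w = partials (mi_word a) w.
Proof.
rewrite /mi_partial /mi_word; elim: (enum 'I_d) => //= i s ->.
by rewrite partials_cat; elim: (nat_of_ord _) => //= n ->.
Qed.

Lemma mi_deg_le r (a : multi_index d r) : (mi_deg a <= r)%N.
Proof. exact: valP a. Qed.

Lemma class_C_mi_partial k r (a : multi_index d r) U w :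
  class_C (k + mi_deg a) U w -> class_C k U (mi_partial a w).
Proof. by rewrite mi_partialE -size_mi_word; exact: class_C_partials. Qed.

(** A directional derivative is the derivative at 0 along the line through
    [t], which reduces the computations below to one real variable. *)
Lemma is_derive_line (f : 'rV[R]_d -> R) (t v : 'rV[R]_d) (df : R) :
  is_derive (0 : R) (1 : R) (fun h : R => f (h *: v + t)) df -> is_derive t v f df.
Proof.
move=> [dl el]; split; first exact/derivable1P.
rewrite -el /derive; congr (lim (_ @ 0^')).
by apply/funext => h /=; rewrite addr0 scale0r add0r /GRing.scale/= mulr1.
Qed.

End class_C_theory.

(** * Bumps and monomials *)

Section ramp.
Context {R : realType}.
Implicit Types x : R.

(** The power [n + 1] of the positive part of [x], of class [C^n]; this form
    makes the derivatives a chain [ramp n.+1], [ramp n], and so on. *)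
Definition ramp n x : R := x ^+ n * Num.max 0 x.

Lemma ramp_gt0 n x : 0 < x -> 0 < ramp n x.
Proof. by move=> x0; rewrite /ramp (max_idPr (ltW x0)) mulr_gt0// exprn_gt0. Qed.

Lemma ramp_eq0 n x : x <= 0 -> ramp n x = 0.
Proof. by move=> x0; rewrite /ramp (max_idPl x0) mulr0. Qed.

Lemma ramp_ge0 n x : 0 <= ramp n x.
Proof. by have [/ramp_eq0->//|/(ramp_gt0 n)/ltW] := leP x 0. Qed.

Lemma continuous_ramp n : continuous (ramp n).
Proof.
move=> x; apply: cvgM; first exact: exprn_continuous.
by apply: (@continuous_max _ _ (fun=> 0) idfun) => //; exact: cvg_cst.
Qed.

(* The case of the square of the positive part, from which the product rule
   gives the others.  At the kink the difference quotient is [Num.max 0 h]. *)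
Let is_derive_ramp1 x : is_derive x 1 (fun y => y * Num.max 0 y) (2%:R * Num.max 0 x).
Proof.
have [x0|x0|->] := ltgtP x 0.
- apply: (@near_eq_is_derive _ _ _ (fun=> 0)).
    by near=> y; rewrite (max_idPl _) ?mulr0//; apply: ltW; near: y; exact: lt_nbhsl.
  by rewrite mulr0; exact: is_derive_cst.
- apply: (@near_eq_is_derive _ _ _ (fun y : R => y * y)).
    by near=> y; rewrite (max_idPr _)//; apply: ltW; near: y; exact: lt_nbhsr.
  by apply: is_derive_eq; rewrite /GRing.scale/= !mulr1 mulrDl mul1r.
- rewrite mulr0.
  have lim0 : (fun h : R => h^-1 *: ((fun y => y * Num.max 0 y) (h *: (1 : R) + 0)
                   - 0 * Num.max 0 0)) @ 0^' --> (0 : R).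
    have : (Num.max 0 h : R) @[h --> 0^'] --> (0 : R).
      have /continuous_withinNx : {for 0, continuous (fun h : R => Num.max 0 h)}.
        by apply: (@continuous_max _ _ (fun=> 0) idfun) => //; exact: cvg_cst.
      by rewrite maxxx.
    apply: cvg_trans; apply: near_eq_cvg; near=> h.
    rewrite addr0 mul0r subr0 /GRing.scale/= mulr1 mulrA mulVf ?mul1r//.
    by near: h; exact: nbhs_dnbhs_neq.
  by apply: DeriveDef; [apply/cvg_ex; exists 0|exact: cvg_lim lim0].
Unshelve. all: by end_near. Qed.

Lemma is_derive_ramp n x : is_derive x 1 (ramp n.+1) (n.+2%:R * ramp n x).
Proof.
have -> : ramp n.+1 = (fun y => y ^+ n) * (fun y => y * Num.max 0 y).
  by apply/funext => y; rewrite /ramp exprSr -mulrA.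
have dX : is_derive x 1 (fun y : R => y ^+ n) (n%:R * x ^+ n.-1).
  split; first exact: exprn_derivable.
  by rewrite exp_derive /GRing.scale/= mulr1.
apply: (is_derive_eq (is_deriveM dX (is_derive_ramp1 x))).
rewrite /GRing.scale/= /ramp.
case: n {dX} => [|n]; first by rewrite expr0; ring.
rewrite /= !exprS -!natr1; ring.
Qed.

End ramp.

Section coordinatewise.
Context {R : realType} {d : nat}.
Implicit Types (t c : 'rV[R]_d).

Lemma scale_delta_coord (i j : 'I_d) (h : R) t :
  (h *: 'e_i + t) ord0 j = h * (i == j)%:R + t ord0 j.
Proof. by rewrite !mxE eqxx /= eq_sym. Qed.

Lemma is_derive_coord (g : R -> R) (dg : R) (i j : 'I_d) t :
  is_derive (t ord0 j) 1 g dg ->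
  is_derive t 'e_i (fun u => g (u ord0 j)) ((i == j)%:R * dg).
Proof.
move=> gd; apply: is_derive_line.
under eq_fun do rewrite scale_delta_coord.
have [_|_] := eqVneq i j; last first.
  by under eq_fun do rewrite mulr0 add0r; rewrite mul0r; exact: is_derive_cst.
have dl : is_derive (0 : R) 1 (fun h : R => h * 1 + t ord0 j) 1.
  by apply: is_derive_eq; rewrite /GRing.scale/= !(mulr1, mulr0, addr0, add0r).
rewrite mul1r -[dg]mulr1; apply: (@is_derive1_comp _ g) => //.
by rewrite mul0r add0r.
Qed.

Lemma class_C_ramp n k (s b : R) (j : 'I_d) : (k <= n)%N ->
  class_C k setT (fun t => ramp n (s * t ord0 j + b)).
Proof.
have affine (t : 'rV[R]_d) : {for t, continuous (fun u : 'rV[R]_d => s * u ord0 j + b)}.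
  apply: (@continuousD _ _ _ (fun u : 'rV[R]_d => s * u ord0 j) (fun=> b)).
    apply: (@continuousM _ _ (fun=> s) (fun u : 'rV[R]_d => u ord0 j)).
      exact: cst_continuous.
    exact: coord_continuous.
  exact: cst_continuous.
have cont m (t : 'rV[R]_d) :
    {for t, continuous (fun u : 'rV[R]_d => ramp m (s * u ord0 j + b))}.
  exact: continuous_comp (affine t) (@continuous_ramp _ m _).
elim: k n => [|k IH] [//|n] kn; (split; first by move=> t _; exact: cont) => // i.
have D t : is_derive t 'e_i (fun t => ramp n.+1 (s * t ord0 j + b))
    ((i == j)%:R * (n.+2%:R * s) * ramp n (s * t ord0 j + b)).
  rewrite -mulrA; apply: (@is_derive_coord (fun x => ramp n.+1 (s * x + b))).
  have dl : is_derive (t ord0 j) 1 (fun x : R => s * x + b) s.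
    by apply: is_derive_eq; rewrite /GRing.scale/= !(mulr1, mulr0, addr0, add0r).
  rewrite mulrAC; apply: (@is_derive1_comp _ (ramp n.+1)) => //.
  exact: is_derive_ramp.
split=> [t _|]; first by case: (D t).
rewrite /partial (_ : (fun t => _) = fun t =>
   ((i == j)%:R * (n.+2%:R * s)) * ramp n (s * t ord0 j + b)).
  by apply: class_CZ; [exact: openT|exact: IH].
by apply/funext => t; rewrite derive_val.
Qed.

(** A [C^n] function that is positive exactly on the open cube of radius [e]
    centred at [c]. *)
Definition bump n c (e : R) t : R :=
  \prod_(j < d) (ramp n (1 * t ord0 j + (e - c ord0 j)) *
                 ramp n (-1 * t ord0 j + (e + c ord0 j))).

Lemma class_C_bump n c e : class_C n setT (bump n c e).
Proof.
by apply: class_C_prod => [|j]; [exact: openT|apply: class_CM;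
  [exact: openT|exact: class_C_ramp|exact: class_C_ramp]].
Qed.

Lemma bump_ge0 n c e t : 0 <= bump n c e t.
Proof. by apply: prodr_ge0 => j _; rewrite mulr_ge0 ?ramp_ge0. Qed.

Lemma bump_gt0 n c e t : (forall j, `|t ord0 j - c ord0 j| < e) -> 0 < bump n c e t.
Proof.
move=> te; apply: prodr_gt0 => j _; have := te j; rewrite ltr_norml => /andP[? ?].
by rewrite mulr_gt0// ramp_gt0; lra.
Qed.

Lemma bump_eq0 n c e t j : e <= `|t ord0 j - c ord0 j| -> bump n c e t = 0.
Proof.
rewrite ler_normr => te; rewrite /bump (bigD1 j)//=.
by case/orP: te => te; [rewrite [X in _ * X * _]ramp_eq0|rewrite ramp_eq0];
  rewrite ?(mul0r, mulr0)//; lra.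
Qed.

(** The one-variable factors are arbitrary polynomials, so that the family is
    closed under partial derivatives. *)
Definition monomial (p : 'I_d -> {poly R}) t : R := \prod_(j < d) (p j).[t ord0 j].

Lemma is_derive_monomial p i t : is_derive t 'e_i (monomial p)
  (monomial (fun j => if j == i then (p j)^`() else p j) t).
Proof.
rewrite /monomial (bigD1 i)//= eqxx.
under eq_bigr => j /negPf -> do [].
under [X in is_derive _ _ X]eq_fun do rewrite (bigD1 i)//= mulrC.
apply: is_derive_line.
under eq_fun => h.
  under eq_bigr => j /negPf ji.
    by rewrite scale_delta_coord eq_sym ji mulr0 add0r; over.
  rewrite scale_delta_coord eqxx; over.
rewrite mulrC.
have dl : is_derive (0 : R) 1 (fun h : R => h * 1 + t ord0 i) 1.
  by apply: is_derive_eq; rewrite /GRing.scale/= !(mulr1, mulr0, addr0, add0r).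
have D : is_derive (0 : R) 1 (horner (p i) \o (fun h : R => h * 1 + t ord0 i))
    ((p i)^`().[t ord0 i] * 1).
  apply: (is_derive1_comp _ dl); rewrite mul0r add0r; exact: is_derive_poly.
rewrite -[(p i)^`().[_]]mulr1; exact: (is_deriveZ _ D).
Qed.

Lemma partial_monomial p i :
  partial i (monomial p) = monomial (fun j => if j == i then (p j)^`() else p j).
Proof.
by apply/funext => t; have D := is_derive_monomial p i t; rewrite /partial derive_val.
Qed.

Lemma class_C_horner_coord k (p : {poly R}) (j : 'I_d) :
  class_C k setT (fun t => p.[t ord0 j]).
Proof.
have cont (q : {poly R}) (t : 'rV[R]_d) :
    {for t, continuous (fun u : 'rV[R]_d => q.[u ord0 j])}.
  exact: continuous_comp (@coord_continuous _ _ _ ord0 j t) (@continuous_horner _ q _).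
elim: k p => [|k IH] p; (split; first by move=> t _; exact: cont) => // i.
have D t := @is_derive_coord (horner p) _ i j t (is_derive_poly p _).
split=> [t _|]; first by case: (D t).
rewrite /partial (_ : (fun t => _) = fun t => (i == j)%:R * p^`().[t ord0 j]).
  by apply: class_CZ; [exact: openT|exact: IH].
by apply/funext => t; have Dt := D t; rewrite derive_val.
Qed.

Lemma class_C_monomial k p : class_C k setT (monomial p).
Proof.
by apply: class_C_prod => [|j]; [exact: openT|exact: class_C_horner_coord].
Qed.

Lemma mi_partial_monomial r (a : multi_index d r) p :
  mi_partial a (monomial p) = monomial (fun j => (p j)^`(val a j)).
Proof.
rewrite /mi_partial; set F := fun i v => _.
have iter_partial n i q : iter n (partial i) (monomial q) =
    monomial (fun j => if j == i then (q j)^`(n) else q j).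
  elim: n => [|n IH] /=; first by congr monomial; apply/funext => j; case: ifP.
  rewrite IH partial_monomial; congr monomial; apply/funext => j.
  by case: ifP => ji; rewrite ?ji.
suff H (s : seq 'I_d) : uniq s -> foldr F (monomial p) s =
    monomial (fun j => if j \in s then (p j)^`(val a j) else p j).
  rewrite H ?enum_uniq//; congr monomial; apply/funext => j.
  by rewrite mem_enum.
elim: s => [_|i s IH /= /andP[nis us]] //=.
rewrite IH// /F iter_partial; congr monomial; apply/funext => j.
rewrite inE; case: eqVneq => [->|]//=.
by rewrite (negPf nis).
Qed.

End coordinatewise.

(** * Lebesgue integrals of compactly supported functions *)

Section cube.
Context {R : realType} {d : nat}.
Implicit Types (c : 'I_d -> R) (e : R) (g : 'rV[R]_d -> R).

Definition cube c e := [set t : 'rV[R]_d | forall i, c i - e <= t ord0 i <= c i + e].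

Lemma compact_cube c e : compact (cube c e).
Proof.
exact: (@rV_compact R d (fun i => `[c i - e, c i + e]%classic)
  (fun i => @segment_compact _ _ _)).
Qed.

Lemma closed_cube c e : closed (cube c e).
Proof. by apply: compact_closed; [exact: norm_hausdorff|exact: compact_cube]. Qed.

Lemma measurable_closed_rV (A : set 'rV[R]_d) : closed A -> measurable A.
Proof.
move=> cA; rewrite -[A]setCK; apply: measurableC; apply: rV_open_measurable.
exact: closed_openC.
Qed.

Lemma cube_fin_measure c e : 0 <= e -> (rV_lebesgue d (cube c e) < +oo)%E.
Proof.
move=> e0; rewrite (rV_lebesgue_box (a := fun i => c i - e) (b := fun i => c i + e)) ?ltry//.
by move=> i; lra.
Qed.

Lemma continuous_measurable_rV g : continuous g -> measurable_fun setT g.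
Proof.
move=> cg; apply: (measurability _ (RGenOpens.measurableE R)).
move=> _ [_ [a [b ->] <-]]; rewrite setTI; apply: rV_open_measurable.
by apply: open_comp; [move=> t _; exact: cg|exact: interval_open].
Qed.

Definition cont_supp (K : set 'rV[R]_d) g :=
  continuous g /\ forall t, ~ K t -> g t = 0.

Lemma cont_supp_integrable c e g : 0 <= e -> cont_supp (cube c e) g ->
  (rV_lebesgue d).-integrable setT (EFin \o g).
Proof.
move=> e0 [cg g0]; have mK := measurable_closed_rV (@closed_cube c e).
have -> : EFin \o g = (EFin \o g) \_ (cube c e).
  apply/funext => t; rewrite patchE; case: ifPn => //.
  by rewrite notin_setE /= => /g0 ->.
apply/(integrable_mkcond _ mK).
apply: measurable_bounded_integrable => //.
- exact: cube_fin_measure.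
- exact: measurable_funS (continuous_measurable_rV cg).
- have := compact_bounded (continuous_compact (continuous_subspaceT cg) (@compact_cube c e)).
  move=> [M [Mr gM]]; exists M; split=> // x /gM H t /= Kt.
  by apply: H; exists t.
Qed.

End cube.

Section integral_derivative.
Context {R : realType}.
Local Notation mu := (@lebesgue_measure R).

(** The fundamental theorem of calculus on an interval slightly larger than
    the support, at whose end points [F] vanishes. *)
Lemma integral_derive1_eq0 (F : R -> R) (a b : R) :
  (forall x, derivable F x 1) -> continuous (F^`()%classic) ->
  (forall x, ~ (a <= x <= b) -> F x = 0) -> a <= b ->
  (\int[mu]_x (F^`()%classic x)%:E = 0)%E.
Proof.
move=> dF cF F0 ab.
have F'0 x : ~ (a <= x <= b) -> F^`()%classic x = 0.
  move=> nx; rewrite derive1E.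
  have oC : open (~` `[a, b]%classic : set R) by exact/closed_openC/itv_closed.
  rewrite (@near_eq_derive _ _ _ F (fun=> 0)) ?derive_cst//.
  have Cx : (~` `[a, b]%classic : set R) x by move=> /=; rewrite in_itv.
  have := open_nbhs_nbhs (conj oC Cx); apply: filterS => y /= yab.
  by apply: F0; move: yab; rewrite in_itv.
have -> : (fun x => (F^`()%classic x)%:E) =
    (fun x => (F^`()%classic x)%:E) \_ `[a - 1, b + 1]%classic.
  apply/funext => x; rewrite patchE; case: ifPn => // /negP.
  rewrite inE /= in_itv/= => nx; rewrite F'0// => /andP[ax xb]; apply: nx.
  by apply/andP; split; lra.
rewrite -integral_mkcond.
have cont x : {for x, continuous F}.
  by apply/differentiable_continuous/derivable1_diffP.
rewrite (@continuous_FTC2 _ _ F).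
- by rewrite !F0 ?subee// => /andP[? ?]; lra.
- by lra.
- exact: continuous_subspaceT.
- split=> [x _||]; first exact: dF.
  + exact/cvg_at_right_filter/cont.
  + exact/cvg_at_left_filter/cont.
- by [].
Qed.

Lemma rV_cons_line0 d (h x : R) (v : 'rV[R]_d) :
  rV_cons (h *: 1 + x, v) = h *: 'e_ord0 + rV_cons (x, v).
Proof.
apply/rowP => i; rewrite scale_delta_coord; case: (unliftP ord0 i) => [j|] ->.
  by rewrite !rV_consES/= mulr0 add0r.
by rewrite !rV_consE0.
Qed.

Lemma rV_cons_lineS d (h x : R) (v : 'rV[R]_d) (j : 'I_d) :
  rV_cons (x, h *: 'e_j + v) = h *: 'e_(lift ord0 j) + rV_cons (x, v).
Proof.
apply/rowP => i; rewrite scale_delta_coord; case: (unliftP ord0 i) => [k|] ->.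
  by rewrite !rV_consES scale_delta_coord (inj_eq lift_inj).
by rewrite !rV_consE0/= mulr0 add0r.
Qed.

Lemma continuous_rV_cons0 d (v : 'rV[R]_d) : continuous (fun x : R => rV_cons (x, v)).
Proof.
move=> x; have -> : (fun x => rV_cons (x, v)) = (fun x : R => x *: 'e_ord0 + rV_cons (0, v)).
  by apply/funext => y; rewrite -rV_cons_line0 addr0 /GRing.scale/= mulr1.
by apply: cvgD; [exact: scalel_continuous|exact: cvg_cst].
Qed.

Lemma continuous_rV_consS d (x : R) : continuous (fun v : 'rV[R]_d => rV_cons (x, v)).
Proof.
move=> v A /nbhs_ballP[e /= e0 eA]; apply/nbhs_ballP; exists e => // w [_ vw].
apply: eA; split=> // i j; rewrite ord1; case: (unliftP ord0 j) => [k|] ->.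
  by rewrite !rV_consES; exact: vw.
by rewrite !rV_consE0; exact: ballxx.
Qed.

(** The Lebesgue measure lives on [measurableTypeR R], which has the same
    measurable sets as [R] but another display. *)
Lemma measurable_rV_cons_lebesgue d :
  measurable_fun [set: (measurableTypeR R * 'rV[R]_d)%type] (@rV_cons R d).
Proof. by move=> mT Y mY; exact: measurable_rV_cons. Qed.

Lemma integral_rV_lebesgueS d (g : 'rV[R]_d.+1 -> R) :
  (rV_lebesgue d.+1).-integrable setT (EFin \o g) ->
  (mu \x rV_lebesgue d)%E.-integrable setT (EFin \o g \o rV_cons) /\
  (\int[rV_lebesgue d.+1]_t (g t)%:E =
   \int[mu \x rV_lebesgue d]_p (g (rV_cons p))%:E)%E.
Proof.
move=> /integrableP[mg ig].
have mgc : measurable_fun [set: (measurableTypeR R * 'rV[R]_d)%type] (EFin \o g \o @rV_cons R d).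
  exact: measurableT_comp mg (@measurable_rV_cons_lebesgue d).
have igc : (mu \x rV_lebesgue d)%E.-integrable setT (EFin \o g \o rV_cons).
  apply/integrableP; split => //.
  move: ig; rewrite /= /rV_lebesgue_step ge0_integral_pushforward//.
    exact: measurable_rV_cons_lebesgue.
  exact: (measurableT_comp (@abse_measurable _ _) mg).
split=> //; rewrite /= /rV_lebesgue_step integral_pushforward//.
exact: measurable_rV_cons_lebesgue.
Qed.

(** Induction on the dimension along the recursive definition of the Lebesgue
    measure.  If [i] is the first coordinate, integrate over it first: the inner
    integral is that of a derivative in one variable.  Otherwise integrate over
    the remaining coordinates first and use the induction hypothesis on the
    slices. *)
Lemma integral_partial_eq0 d (c : 'I_d -> R) (e : R) (g : 'rV[R]_d -> R) (i : 'I_d) :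
  0 <= e -> cont_supp (cube c e) g -> (forall t, derivable g t 'e_i) ->
  continuous (partial i g) -> (\int[rV_lebesgue d]_t (partial i g t)%:E = 0)%E.
Proof.
elim: d c g i => [c g []//|d IH] c g i e0 [cg g0] dg cg'.
have g'0 t : ~ cube c e t -> partial i g t = 0.
  by apply: partial_vanish => //; exact: closed_cube.
have [int ->] := integral_rV_lebesgueS (cont_supp_integrable e0 (conj cg' g'0)).
case: (unliftP ord0 i) => [j|] ij.
- rewrite -integral12_prod_meas1//=; apply: integral0_eq => x _.
  rewrite /fubini_F.
  have slice v : partial i g (rV_cons (x, v)) = partial j (fun v => g (rV_cons (x, v))) v.
    rewrite /partial /derive; congr (lim (_ @ 0^')); apply/funext => h /=.
    by rewrite rV_cons_lineS ij.
  under eq_integral do rewrite slice.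
  apply: (IH (c \o lift ord0)) => //.
  + split=> [v|v nv]; first exact: continuous_comp (@continuous_rV_consS _ _ _) (cg _).
    apply: g0 => H; apply: nv => k; have := H (lift ord0 k).
    by rewrite rV_consES.
  + move=> v; have := dg (rV_cons (x, v)); rewrite /derivable; set A := (fun _ => _).
    suff -> : A = fun h : R => h^-1 *: (((fun v => g (rV_cons (x, v))) \o shift v) (h *: 'e_j)
        - g (rV_cons (x, v))) by [].
    by apply/funext => h; rewrite /A/= ij -rV_cons_lineS.
  + rewrite -(funext slice) => v.
    exact: continuous_comp (@continuous_rV_consS _ _ _) (cg' _).
- rewrite -integral21_prod_meas1//=; apply: integral0_eq => v _.
  rewrite /fubini_G.
  have slice x : partial i g (rV_cons (x, v)) = (fun x => g (rV_cons (x, v)))^`()%classic x.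
    rewrite derive1E /partial /derive; congr (lim (_ @ 0^')); apply/funext => h /=.
    by rewrite rV_cons_line0 ij.
  under eq_integral do rewrite slice.
  apply: (@integral_derive1_eq0 _ (c ord0 - e) (c ord0 + e)).
  + move=> x; have := dg (rV_cons (x, v)); rewrite /derivable; set A := (fun _ => _).
    suff -> : A = fun h : R => h^-1 *: (((fun x => g (rV_cons (x, v))) \o shift x) (h *: 1)
        - g (rV_cons (x, v))) by [].
    by apply/funext => h; rewrite /A/= ij -rV_cons_line0.
  + rewrite -(funext slice) => x.
    exact: continuous_comp (@continuous_rV_cons0 _ _ _) (cg' _).
  + by move=> x nx; apply: g0 => H; apply: nx; have := H ord0; rewrite rV_consE0.
  + by lra.
Qed.

End integral_derivative.

(** * Integration by parts and the adjoint operator *)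

Section integration_by_parts.
Context {R : realType} {d : nat}.
Local Notation leb := (rV_lebesgue d).
Implicit Types (c : 'I_d -> R) (e : R) (g u phi : 'rV[R]_d -> R) (U : set 'rV[R]_d).

Lemma class_C0_continuous k u : class_C k setT u -> continuous u.
Proof. by move=> Cu t; exact: class_C_continuous Cu _. Qed.

Lemma cont_suppZ (K : set 'rV[R]_d) (a : R) g :
  cont_supp K g -> cont_supp K (fun t => a * g t).
Proof.
move=> [cg g0]; split=> [t|t nt]; last by rewrite g0 ?mulr0.
by apply: (@continuousM _ _ (fun=> a) g); [exact: cst_continuous|exact: cg].
Qed.

Lemma Rintegral_cont_supp_sum c e (I : Type) (s : seq I) (F : I -> 'rV[R]_d -> R) :
  0 <= e -> (forall j, cont_supp (cube c e) (F j)) ->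
  \int[leb]_t (\sum_(j <- s) F j t) = \sum_(j <- s) \int[leb]_t F j t.
Proof.
move=> e0 CF; elim: s => [|j s IH].
  under eq_Rintegral do rewrite big_nil.
  by rewrite big_nil Rintegral_cst// mul0r.
under eq_Rintegral do rewrite big_cons.
rewrite big_cons -IH RintegralD//; first exact: cont_supp_integrable (CF j).
apply: (@cont_supp_integrable _ _ c e) => //; split=> [|t nt].
- apply: (@class_C0_continuous 0); apply: class_C_sum => [|k]; first exact: openT.
  by split=> // t _; exact: (CF k).1.
- by rewrite big1// => k _; exact: (CF k).2.
Qed.

(** The product [u phi] has compact support inside [U], hence the integral of
    its partial derivative vanishes; the product rule holds on the support and
    trivially off it. *)
Lemma integral_by_parts c e U u phi (i : 'I_d) : 0 <= e -> open U -> cube c e `<=` U ->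
  class_C 1 U u -> class_C 1 setT phi -> (forall t, ~ cube c e t -> phi t = 0) ->
  \int[leb]_t (partial i u t * phi t) = - \int[leb]_t (u t * partial i phi t).
Proof.
move=> e0 oU KU Cu Cphi phi0; set K := cube c e.
have cK : closed K by exact: closed_cube.
have phi'0 : forall t, ~ K t -> partial i phi t = 0 by exact: partial_vanish.
have C1 : class_C 1 setT (fun t => u t * phi t).
  exact: (class_C_mul_cutoff oU cK KU).
have s1 : cont_supp K (fun t => partial i u t * phi t).
  split=> [|t nt]; last by rewrite phi0 ?mulr0.
  apply: (@class_C0_continuous 0); apply: (class_C_mul_cutoff oU cK KU phi0).
    exact: class_C_partial.
  exact: class_CS.
have s2 : cont_supp K (fun t => u t * partial i phi t).
  split=> [|t nt]; last by rewrite phi'0 ?mulr0.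
  apply: (@class_C0_continuous 0); apply: (class_C_mul_cutoff oU cK KU phi'0).
    exact: class_CS.
  exact: class_C_partial.
have uphi0 t : ~ K t -> u t * phi t = 0 by move=> nt; rewrite phi0 ?mulr0.
have leibniz t : partial i (fun t => u t * phi t) t =
    u t * partial i phi t + partial i u t * phi t.
  have [Kt|nKt] := pselect (K t); last first.
    by rewrite (partial_vanish i cK uphi0)// phi0// phi'0// !mulr0 addr0.
  rewrite partialM; [by rewrite [phi t * _]mulrC| |exact: class_C_derivable Cphi _].
  by apply: class_C_derivable Cu _; exact: KU.
apply/eqP; rewrite -addr_eq0 addrC -RintegralD//; last 2 first.
- exact: cont_supp_integrable s2.
- exact: cont_supp_integrable s1.
apply/eqP; under eq_Rintegral do rewrite -leibniz.
rewrite /Rintegral (@integral_partial_eq0 _ _ c e)//.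
- by split=> //; exact: (class_C0_continuous C1).
- by move=> t; exact: class_C_derivable C1 _.
- exact/(class_C0_continuous (k := 0))/class_C_partial.
Qed.

(** Moving the letters of [s] from [u] to [phi] one by one, outermost first,
    reverses their order. *)
Lemma integral_by_parts_word c e U u phi (s : seq 'I_d) :
  0 <= e -> open U -> cube c e `<=` U ->
  class_C (size s) U u -> class_C (size s) setT phi ->
  (forall t, ~ cube c e t -> phi t = 0) ->
  \int[leb]_t (partials s u t * phi t) =
  (-1) ^+ size s * \int[leb]_t (u t * partials (rev s) phi t).
Proof.
move=> e0 oU KU; elim: s phi => [|i s IH] phi Cu Cphi phi0; first by rewrite mul1r.
rewrite /= (@integral_by_parts c e U)//; last 2 first.
- by apply: class_C_partials; rewrite add1n.
- exact: class_C_le Cphi.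
rewrite IH; [|exact: class_CS|exact: class_C_partial|]; last first.
  by apply: partial_vanish => //; exact: closed_cube.
by rewrite rev_cons partials_rcons exprS mulN1r mulNr.
Qed.

Definition pdo_adjoint U r (L : param_diff_op U r) phi : 'rV[R]_d -> R :=
  fun t => \sum_(a : multi_index d r)
    (-1) ^+ mi_deg a * partials (rev (mi_word a)) (fun t => pdo_coef L a t * phi t) t.

Section adjoint.
Variables (c : 'I_d -> R) (e : R) (U : set 'rV[R]_d) (r : nat) (L : param_diff_op U r).
Hypotheses (e0 : 0 <= e) (oU : open U) (KU : cube c e `<=` U).
Variable phi : 'rV[R]_d -> R.
Hypotheses (Cphi : class_C r setT phi) (phi0 : forall t, ~ cube c e t -> phi t = 0).

Let cK : closed (cube c e). Proof. exact: closed_cube. Qed.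

Let coef_phi_C a : class_C (mi_deg a) setT (fun t => pdo_coef L a t * phi t).
Proof.
apply: (class_C_mul_cutoff oU cK KU phi0); first exact: pdo_coefC.
exact: class_C_le (mi_deg_le a) Cphi.
Qed.

Let coef_phi0 a t : ~ cube c e t -> pdo_coef L a t * phi t = 0.
Proof. by move=> nt; rewrite phi0 ?mulr0. Qed.

Let adjoint_term_C a :
  class_C 0 setT (partials (rev (mi_word a)) (fun t => pdo_coef L a t * phi t)).
Proof. by apply: class_C_partials; rewrite add0n size_rev size_mi_word. Qed.

Let adjoint_term0 a t : ~ cube c e t ->
  partials (rev (mi_word a)) (fun t => pdo_coef L a t * phi t) t = 0.
Proof. by apply: partials_vanish => // u; exact: coef_phi0. Qed.

Lemma pdo_adjoint_cont_supp : cont_supp (cube c e) (pdo_adjoint L phi).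
Proof.
split=> [|t nt]; last first.
  by rewrite /pdo_adjoint big1// => a _; rewrite adjoint_term0 ?mulr0.
apply: (@class_C0_continuous 0); apply: class_C_sum => [|a]; first exact: openT.
by apply: class_CZ; [exact: openT|exact: adjoint_term_C].
Qed.

Lemma pdo_adjointP u : class_C r U u ->
  \int[leb]_t (u t * pdo_adjoint L phi t) = \int[leb]_t (pdo_apply L u t * phi t).
Proof.
move=> Cu; rewrite /pdo_adjoint /pdo_apply.
under eq_Rintegral do rewrite mulr_sumr.
under eq_Rintegral do under eq_bigr do rewrite mulrCA.
under [RHS]eq_Rintegral do rewrite mulr_suml.
have Cua (a : multi_index d r) : class_C (mi_deg a) U u by apply: class_C_le Cu; exact: mi_deg_le.
have cont_term (a : multi_index d r) : cont_supp (cube c e)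
    (fun t => u t * partials (rev (mi_word a)) (fun t => pdo_coef L a t * phi t) t).
  split=> [|t nt]; last by rewrite adjoint_term0 ?mulr0.
  apply: (@class_C0_continuous 0).
  apply: (class_C_mul_cutoff oU cK KU (@adjoint_term0 a)) => //.
  exact: class_C_le Cu.
rewrite (@Rintegral_cont_supp_sum c e)//; last first.
  by move=> a; exact: cont_suppZ (cont_term a).
rewrite (@Rintegral_cont_supp_sum c e)//; last first.
  move=> a; split=> [|t nt]; last by rewrite phi0 ?mulr0.
  apply: (@class_C0_continuous 0); apply: (class_C_mul_cutoff oU cK KU phi0).
    apply: class_CM => //; first exact: class_C_le (pdo_coefC L a).
    by apply: class_C_mi_partial; rewrite add0n.
  exact: class_C_le Cphi.
apply: eq_bigr => a _.
transitivity (\int[leb]_t (partials (mi_word a) u t * (pdo_coef L a t * phi t))).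
  rewrite (@integral_by_parts_word c e U)//; last 3 first.
  - by rewrite size_mi_word.
  - by rewrite size_mi_word.
  - exact: coef_phi0.
  rewrite RintegralZl//; last exact: cont_supp_integrable (cont_term a).
  by rewrite size_mi_word.
by apply: eq_Rintegral => t _; rewrite mi_partialE mulrA [pdo_coef _ _ _ * _]mulrC.
Qed.

End adjoint.

End integration_by_parts.

(** * Functions orthogonal to the solutions of the equation *)

Section annihilator.
Context {R : realType} {d : nat}.
Local Notation leb := (rV_lebesgue d).
Implicit Types (c t : 'rV[R]_d) (e : R) (g u : 'rV[R]_d -> R) (U V : set 'rV[R]_d).

(** After translation to the origin this is the derivative of ['X^n] at 0. *)
Lemma horner_derivn_XsubC_exp (a : R) n k :
  ((('X - a%:P) ^+ n)^`(k)).[a] = if k == n then n`!%:R else 0.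
Proof.
have compE (p : {poly R}) : (p \Po ('X - a%:P))^`(k) = p^`(k) \Po ('X - a%:P).
  elim: k => [|k IH]; first by rewrite !derivn0.
  by rewrite !derivnS IH deriv_comp derivXsubC mulr1.
have -> : ('X - a%:P) ^+ n = 'X^n \Po ('X - a%:P) by rewrite comp_Xn_poly.
rewrite compE horner_comp derivnXn hornerMn hornerXsubC subrr hornerXn expr0n.
have [->|kn] := eqVneq k n; first by rewrite subnn eqxx ffactnn.
have [ltnk|ltkn|eqkn] := ltngtP n k.
- by rewrite ffact_small.
- by rewrite subn_eq0 leqNgt ltkn mul0rn.
- by rewrite eqkn eqxx in kn.
Qed.

(** For the monomial [(t' - t)^a] all derivatives at [t] vanish except the one
    of multi-index [a], so the operator isolates the coefficient of [a]. *)
Lemma pdo_apply_monomial_neq0 U r (L : param_diff_op U r) (a : multi_index d r) t :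
  pdo_coef L a t != 0 -> exists p, pdo_apply L (monomial p) t != 0.
Proof.
move=> Lat; exists (fun j => ('X - (t ord0 j)%:P) ^+ (val a j)).
rewrite /pdo_apply (bigD1 a)//= big1 ?addr0 => [|b ba].
  rewrite mi_partial_monomial mulf_neq0//; apply/prodf_neq0 => j _.
  by rewrite horner_derivn_XsubC_exp eqxx pnatr_eq0 -lt0n fact_gt0.
rewrite mi_partial_monomial; have [j bj] : exists j, val b j != val a j.
  apply/existsP; rewrite -negb_forall; apply: contra ba => /forallP ba.
  by apply/eqP/val_inj/ffunP => j; exact/eqP.
rewrite /monomial (bigD1 j)//= horner_derivn_XsubC_exp.
by rewrite (inj_eq val_inj) (negPf bj) mul0r mulr0.
Qed.

Lemma cube_measure_gt0 (c : 'I_d -> R) e : 0 < e -> (0 < leb (cube c e))%E.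
Proof.
move=> e0; rewrite (rV_lebesgue_box (a := fun i => c i - e) (b := fun i => c i + e)).
  by rewrite lte_fin; apply: prodr_gt0 => i _; lra.
by move=> i; lra.
Qed.

Lemma Rintegral_neq0_of_gt0_on_cube (c c' : 'I_d -> R) e e' g : 0 <= e -> 0 < e' ->
  cont_supp (cube c e) g -> (forall t, 0 <= g t) ->
  (forall t, cube c' e' t -> 0 < g t) -> \int[leb]_t g t != 0.
Proof.
move=> e0 e'0 sg g0 gpos; apply/eqP => ig0.
have ig := cont_supp_integrable e0 sg.
have mg : measurable_fun setT (EFin \o g) by exact: measurable_int ig.
have : ae_eq leb setT (EFin \o g) (cst 0%E).
  apply/(ae_eq_integral_abs _ measurableT mg).
  under eq_integral do rewrite /= ger0_norm//.
  move: ig0; rewrite /Rintegral => ig0.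
  by rewrite -[LHS]fineK ?ig0//; exact: integrable_fin_num ig.
move=> [N [mN N0 sub]].
have : (leb (cube c' e') <= leb N)%E.
  apply: le_measure; rewrite ?inE//; first by apply: measurable_closed_rV; exact: closed_cube.
  move=> t /gpos gt; apply: sub => /= /(_ I) [] gt0.
  by move: gt; rewrite gt0 ltxx.
by rewrite N0 leNgt cube_measure_gt0.
Qed.

Lemma cont_supp_bounded (c : 'I_d -> R) e g : cont_supp (cube c e) g ->
  exists2 M, 0 < M & forall t, `|g t| <= M.
Proof.
move=> [cg g0].
have := compact_bounded (continuous_compact (continuous_subspaceT cg) (@compact_cube _ _ c e)).
move=> [M [Mr gM]]; exists (Num.max 0 M + 1).
  by rewrite ltr_pwDr// le_max lexx.
move=> t; have [Kt|/g0->] := pselect (cube c e t).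
  apply: (gM (Num.max 0 M + 1)); last by exists t.
  by rewrite ltr_pwDr// le_max lexx orbT.
by rewrite normr0 addr_ge0// le_max lexx.
Qed.

Lemma nbhs_contains_cube V t : nbhs t V ->
  exists2 e, 0 < e & cube (t ord0) e `<=` V.
Proof.
move=> /nbhs_ballP[e /= e0 eV].
exists (e / 2); first by rewrite divr_gt0.
move=> u ut; apply: eV; split=> // i j; rewrite ord1 /ball/= ltr_distl.
by have /andP[? ?] := ut j; apply/andP; split; lra.
Qed.

(** The function [h] is the adjoint applied to a bump around [t0], scaled to
    have values in [-m, m].  It is not null because its integral against a
    monomial [w] is that of [(L w) phi], and the bump is supported where [L w]
    has the sign of its value [v0] at [t0]. *)
Lemma exists_pde_annihilator U r (L : param_diff_op U r) V (m : R)
    (a : multi_index d r) t0 : open U -> open V -> V `<=` U -> 0 < m ->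
  V t0 -> pdo_coef L a t0 != 0 ->
  exists (c : 'I_d -> R) e h, [/\ 0 <= e, cube c e `<=` V, cont_supp (cube c e) h &
  [/\ forall t, `|h t| <= m,
      forall u, class_C r U u -> (forall t, U t -> pdo_apply L u t = 0) ->
        cont_supp (cube c e) (fun t => u t * h t) /\ \int[leb]_t (u t * h t) = 0 &
      ~ {ae leb, forall t, h t = 0}]].
Proof.
move=> oU oV VU m0 Vt0 Lat0; have [p Lp] := pdo_apply_monomial_neq0 Lat0.
pose w : 'rV[R]_d -> R := monomial p; pose v0 := pdo_apply L w t0.
have Cw : class_C r setT w by exact: class_C_monomial.
have CwU : class_C r U w by exact: class_C_subset Cw.
have CLw : class_C 0 U (pdo_apply L w).
  apply: class_C_sum => // b; apply: class_CM => //; first exact: class_C_le (pdo_coefC L b).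
  by apply: class_C_mi_partial; rewrite add0n; apply: class_C_le CwU; exact: mi_deg_le.
(* Multiplying by the value [v0] at [t0] spares a case distinction on its
   sign. *)
have [e e0 eV] : exists2 e, 0 < e &
    cube (t0 ord0) e `<=` V `&` [set t | 0 < v0 * pdo_apply L w t].
  apply: nbhs_contains_cube; apply: filterI; first exact: open_nbhs_nbhs.
  have cvgL : v0 * pdo_apply L w t @[t --> t0] --> v0 * v0.
    exact: cvgM (cvg_cst _) (class_C_continuous CLw (VU _ Vt0)).
  by apply: (cvgr_gt _ cvgL); rewrite -expr2 lt0r sqr_ge0 sqrf_eq0 Lp.
have KV : cube (t0 ord0) e `<=` V by move=> t /eV[].
have KU : cube (t0 ord0) e `<=` U by move=> t /KV /VU.
pose phi := bump r t0 e.
have phi0 t : ~ cube (t0 ord0) e t -> phi t = 0.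
  move=> nt; have [j jt] : exists j, e <= `|t ord0 j - t0 ord0 j|.
    apply: contrapT => /forallNP H; apply: nt => j.
    have /negP := H j; rewrite -ltNge ltr_distl => /andP[? ?].
    by apply/andP; split; lra.
  exact: bump_eq0 jt.
have Cphi : class_C r setT phi by exact: class_C_bump.
have sh := pdo_adjoint_cont_supp L oU KU Cphi phi0.
have [M M0 hM] := cont_supp_bounded sh.
pose k := m / M; have k0 : 0 < k by rewrite divr_gt0.
have e0' := ltW e0.
have su u : class_C r U u -> cont_supp (cube (t0 ord0) e) (fun t => u t * pdo_adjoint L phi t).
  move=> Cu; split=> [|t nt]; last by rewrite sh.2 ?mulr0.
  apply: (@class_C0_continuous _ _ 0).
  apply: (class_C_mul_cutoff oU _ KU sh.2); first exact: closed_cube.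
    exact: class_C_le Cu.
  by split=> // t _; exact: sh.1.
have intk u : class_C r U u -> \int[leb]_t (u t * (k * pdo_adjoint L phi t)) =
    k * \int[leb]_t (pdo_apply L u t * phi t).
  move=> Cu; under eq_Rintegral do rewrite mulrCA.
  rewrite RintegralZl//; last exact: cont_supp_integrable (su u Cu).
  by congr (k * _); exact: (pdo_adjointP L e0' oU KU).
exists (t0 ord0), e, (fun t => k * pdo_adjoint L phi t); split=> //.
  exact: cont_suppZ.
split=> [t|u Cu Lu0|].
- rewrite normrM (gtr0_norm k0) /k mulrAC ler_pdivrMr// ler_wpM2l//; first exact: ltW.
- split.
    have [cu u0] := cont_suppZ k (su u Cu); split=> [|t /u0]; last by rewrite mulrCA.
    by under eq_fun do rewrite mulrCA.
  rewrite intk// /Rintegral integral0_eq ?mulr0// => t _.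
  have [/KU/Lu0->|/phi0->] := pselect (cube (t0 ord0) e t); first by rewrite mul0r.
  by rewrite mulr0.
- move=> h0ae; suff /eqP : \int[leb]_t (w t * (k * pdo_adjoint L phi t)) != 0.
    apply; have [cwh _] := cont_suppZ k (su w CwU).
    rewrite /Rintegral (@ae_eq_integral _ _ _ _ _ (cst 0%E)) ?integral0//.
      apply/measurable_EFinP; under eq_fun do rewrite mulrCA.
      exact: continuous_measurable_rV.
    by apply: filterS h0ae => t ht _ /=; rewrite ht mulr0.
  rewrite intk// mulf_neq0//; first by rewrite gt_eqF.
  have sLw : cont_supp (cube (t0 ord0) e) (fun t => pdo_apply L w t * phi t).
    split=> [|t nt]; last by rewrite phi0 ?mulr0.
    apply: (@class_C0_continuous _ _ 0).
    apply: (class_C_mul_cutoff oU _ KU phi0) => //; first exact: closed_cube.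
    exact: class_C_le Cphi.
  suff : \int[leb]_t (v0 * (pdo_apply L w t * phi t)) != 0.
    move=> /eqP vI; apply/eqP => I0; apply: vI; rewrite RintegralZl//; last exact: cont_supp_integrable sLw.
    by rewrite I0 mulr0.
  apply: (@Rintegral_neq0_of_gt0_on_cube (t0 ord0) (t0 ord0) e (e / 2)) => //.
  + by rewrite divr_gt0.
  + exact: cont_suppZ.
  + move=> t; rewrite mulrA.
    have [/eV[_ /= Lt]|/phi0->] := pselect (cube (t0 ord0) e t).
      by rewrite mulr_ge0 ?bump_ge0// ltW.
    by rewrite mulr0.
  + move=> t Kt; have Kt' j : `|t ord0 j - t0 ord0 j| < e.
      by have /andP[? ?] := Kt j; rewrite ltr_distl; apply/andP; split; lra.
    rewrite mulrA mulr_gt0 ?bump_gt0//.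
    have /eV[] // : cube (t0 ord0) e t.
    by move=> j; have := Kt' j; rewrite ltr_distl => /andP[? ?]; apply/andP; split; lra.
Qed.

End annihilator.

(** * Densities, perturbed measures and kernels *)

Section density.
Local Open Scope ereal_scope.
Context d (T : measurableType d) (R : realType).
Variables (mu : {sigma_finite_measure set T -> \bar R}) (D : set T) (q : T -> R).
Hypotheses (mD : measurable D) (q0 : forall t, D t -> (0 <= q t)%R).
Hypothesis (iq : mu.-integrable D (EFin \o q)).

Let mq : measurable_fun D (EFin \o q). Proof. exact: measurable_int iq. Qed.

Definition density_measure (A : set T) : \bar R := \int[mu]_(t in A `&` D) (q t)%:E.

Let density0 : density_measure set0 = 0.
Proof. by rewrite /density_measure set0I integral_set0. Qed.

Let density_ge0 A : 0 <= density_measure A.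
Proof. by apply: integral_ge0 => t [_ Dt]; rewrite lee_fin q0. Qed.

Let density_sigma_additive : semi_sigma_additive density_measure.
Proof.
move=> F mF tF mUF; rewrite /density_measure setI_bigcupl.
rewrite ge0_integral_bigcup//.
- apply: is_cvg_nneseries_cond => n _ _; exact: density_ge0.
- by move=> k; exact: measurableI.
- apply: measurable_funS mq => // t [k _ []//].
- by move=> t [k _ [_ Dt]]; rewrite lee_fin q0.
- exact: trivIset_setIr.
Qed.

HB.instance Definition _ := isMeasure.Build _ _ _
  density_measure density0 density_ge0 density_sigma_additive.

Let density_fin : fin_num_fun density_measure.
Proof.
have mAD A : measurable A -> measurable (A `&` D) by move=> mA; exact: measurableI.
move=> A mA; apply: integrable_fin_num; first exact: mAD.
by apply: (integrableS mD _ _ iq) => //; exact: mAD.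
Qed.

HB.instance Definition _ := Measure_isFinite.Build _ _ _
  density_measure density_fin.

(** The Radon-Nikodym derivative of the measure of density [q] is almost
    everywhere [q], since both have the same integrals over measurable sets;
    the formula is thus the change of variables for that derivative. *)
Lemma ge0_integral_density_measure (f : T -> \bar R) :
  (forall t, D t -> 0 <= f t) -> measurable_fun D f ->
  \int[density_measure]_(t in D) f t = \int[mu]_(t in D) (f t * (q t)%:E).
Proof.
move=> f0 mf; pose nu : {finite_measure set T -> \bar R} := density_measure.
have numu : nu `<< mu.
  apply/null_content_dominatesP => A mA A0; rewrite /nu /= /density_measure.
  apply: null_set_integral; first exact: measurableI.
    by apply: measurable_funS mq.
  by apply: (subset_measure0 _ mA _ A0) => //; exact: measurableI.
have -> : \int[density_measure]_(t in D) f t = \int[nu]_(t in D) (f \_ D) t.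
  by rewrite -integralEpatch.
rewrite -(Radon_Nikodym_SigmaFinite.change_of_variables numu)//.
- have RNq : ae_eq mu D (Radon_Nikodym_SigmaFinite.f nu mu) (EFin \o q).
    apply: (integral_ae_eq mD _ mq).
      by apply: (integrableS measurableT) => //; exact: Radon_Nikodym_SigmaFinite.f_integrable.
    move=> A AD mA; rewrite -Radon_Nikodym_SigmaFinite.f_integral//.
    by rewrite /nu /= /density_measure (setIidl AD).
  apply: ae_eq_integral => //.
  + apply: emeasurable_funM; first by apply/(measurable_restrict _ _ _) => //; rewrite setIid.
    apply: measurable_funTS.
    exact: measurable_int (Radon_Nikodym_SigmaFinite.f_integrable numu).
  + exact: emeasurable_funM.
  + apply: filterS RNq => t /[swap] Dt /(_ Dt) ->.
    by rewrite patchE mem_set.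
- by move=> t; rewrite patchE; case: ifPn => //; rewrite inE => /f0.
- by apply/(measurable_restrict _ _ _) => //; rewrite setIid.
Qed.

Lemma ge0_integral_density (nu : {measure set T -> \bar R}) (f : T -> \bar R) :
  (forall A, measurable A -> A `<=` D -> nu A = \int[mu]_(t in A) (q t)%:E) ->
  (forall t, D t -> 0 <= f t) -> measurable_fun D f ->
  \int[nu]_(t in D) f t = \int[mu]_(t in D) (f t * (q t)%:E).
Proof.
move=> nuE f0 mf; rewrite -ge0_integral_density_measure//.
apply: eq_measure_integral => A mA AD; rewrite nuE//= /density_measure.
by rewrite (setIidl AD).
Qed.

Lemma finite_measure_of_density : exists nu : {finite_measure set T -> \bar R},
  forall A, measurable A -> nu A = \int[mu]_(t in A `&` D) (q t)%:E.
Proof. by exists density_measure. Qed.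

End density.

Section perturbation.
Local Open Scope ereal_scope.
Context d (T : measurableType d) (R : realType).
Variables (mu : {sigma_finite_measure set T -> \bar R}) (D : set T) (mD : measurable D).
Variables (G : {finite_measure set T -> \bar R}) (g h : T -> R).
Hypotheses (mg : measurable_fun D g) (g0 : forall t, D t -> (0 <= g t)%R).
Hypothesis GE : forall A, measurable A -> A `<=` D -> G A = \int[mu]_(t in A) (g t)%:E.
Hypothesis ih : mu.-integrable D (EFin \o h).
Hypothesis gh0 : {ae mu, forall t, D t -> (0 <= g t + h t)%R}.

(* The density [g + h] is nonnegative only almost everywhere, hence the
   truncation. *)
Let q t := Num.max (g t + h t)%R 0%R.

Let ig : mu.-integrable D (EFin \o g).
Proof.
apply/integrableP; split; first exact/measurable_EFinP.
under eq_integral => t /[!inE] Dt do rewrite /= ger0_norm ?g0//.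
by rewrite -GE// -ge0_fin_numE// fin_num_measure.
Qed.

Let igh : mu.-integrable D (EFin \o (fun t => g t + h t)%R).
Proof. exact: (integrableD mD ig ih). Qed.

Let iq : mu.-integrable D (EFin \o q).
Proof.
apply: (le_integrable mD _ _ igh).
  apply/measurable_EFinP; apply: measurable_maxr; last exact: measurable_cst.
  exact/measurable_EFinP/(measurable_int _ igh).
move=> t Dt; rewrite /= lee_fin /q; have [gh|gh] := leP (g t + h t)%R 0%R.
  by rewrite normr0.
by [].
Qed.

Let q0 t : D t -> (0 <= q t)%R. Proof. by move=> _; rewrite le_max lexx orbT. Qed.

Let qE : {ae mu, forall t, D t -> q t = (g t + h t)%R}.
Proof. by apply: filterS gh0 => t /[apply] gh; rewrite /q (max_idPl gh). Qed.

(** The measure has density [g + h].  As [f] need not be integrable with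
    respect to [G], the second item cannot be obtained by subtraction: it
    follows from the identity
    << f (g + h) + (f h)^- = f g + (f h)^+ >>
    between nonnegative functions, where the integrals of [(f h)^+] and
    [(f h)^-] are equal and finite and can be cancelled.  In the third item,
    equal measures have almost everywhere equal densities. *)
Lemma exists_perturbed_measure : exists nu : {finite_measure set T -> \bar R},
  [/\ nu (~` D) = 0,
      forall f : T -> R, (forall t, D t -> (0 <= f t)%R) -> measurable_fun D f ->
        mu.-integrable D (EFin \o (fun t => f t * h t)%R) ->
        \int[mu]_(t in D) (f t * h t)%:E = 0 ->
        \int[nu]_(t in D) (f t)%:E = \int[G]_(t in D) (f t)%:E &
      (forall A, measurable A -> nu A = G A) -> ae_eq mu D (EFin \o h) (cst 0)].
Proof.
have [nu nuE] := finite_measure_of_density mD q0 iq.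
exists nu; split.
- by rewrite nuE; [rewrite setICl integral_set0|exact: measurableC].
- move=> f f0 mf ifh ifh0.
  have nuE' A : measurable A -> A `<=` D -> nu A = \int[mu]_(t in A) (q t)%:E.
    by move=> mA AD; rewrite nuE// (setIidl AD).
  have mEf : measurable_fun D (EFin \o f) by exact/measurable_EFinP.
  have f0' t : D t -> 0 <= (f t)%:E by move=> Dt; rewrite lee_fin f0.
  rewrite (ge0_integral_density mD q0 iq nuE')// (ge0_integral_density mD g0 ig GE)//.
  set F := EFin \o (fun t => f t * h t)%R in ifh.
  have Fneg : \int[mu]_(t in D) F^\- t \is a fin_num by exact: integrable_neg_fin_num ifh.
  have Fpos : \int[mu]_(t in D) F^\+ t \is a fin_num by exact: integrable_pos_fin_num ifh.
  have FposE : \int[mu]_(t in D) F^\+ t = \int[mu]_(t in D) F^\- t.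
    have : \int[mu]_(t in D) F t = 0 by exact: ifh0.
    by rewrite integralE -(fineK Fpos) -(fineK Fneg) -EFinB => -[/subr0_eq ->].
  have mF : measurable_fun D F by exact: measurable_int ifh.
  have mfq : measurable_fun D (fun t => (f t)%:E * (q t)%:E).
    by apply: emeasurable_funM => //; exact: measurable_int iq.
  have mfg : measurable_fun D (fun t => (f t)%:E * (g t)%:E).
    by apply: emeasurable_funM => //; exact: measurable_int ig.
  have mFp : measurable_fun D F^\+ by exact: measurable_funepos.
  have mFn : measurable_fun D F^\- by exact: measurable_funeneg.
  have fq0 t : D t -> 0 <= (f t)%:E * (q t)%:E.
    by move=> Dt; rewrite mule_ge0// lee_fin ?f0 ?q0.
  have fg0 t : D t -> 0 <= (f t)%:E * (g t)%:E.
    by move=> Dt; rewrite mule_ge0// lee_fin ?f0 ?g0.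
  have key : \int[mu]_(t in D) ((f t)%:E * (q t)%:E) + \int[mu]_(t in D) F^\- t =
             \int[mu]_(t in D) ((f t)%:E * (g t)%:E) + \int[mu]_(t in D) F^\+ t.
    rewrite -!ge0_integralD//.
    apply: ae_eq_integral => //; [exact: emeasurable_funD|exact: emeasurable_funD|].
    apply: filterS qE => t + Dt => /(_ Dt) ->.
    rewrite !unlock /F /= -!EFin_max -!EFinD. congr EFin.
    by rewrite mulrDr -addrA; congr (_ + _)%R; case: leP => ?; case: leP => ?; lra.
  by move: key; rewrite FposE => /(congr1 (fun z => z - \int[mu]_(t in D) F^\- t)); rewrite !addeK.
- move=> nuG.
  have qg : ae_eq mu D (EFin \o q) (EFin \o g).
    apply: (integral_ae_eq mD iq); first exact/measurable_EFinP.
    by move=> A AD mA; rewrite -GE// -nuG// nuE// (setIidl AD).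
  apply: filterS2 qg qE => t + + Dt => /(_ Dt) /= [qg] /(_ Dt); rewrite qg.
  by move=> E; congr EFin; lra.
Qed.

End perturbation.

Section kernel_mass.
Local Open Scope ereal_scope.
Context d1 d2 (S : measurableType d1) (T : measurableType d2) (R : realType).
Variables (lam : {sigma_finite_measure set S -> \bar R}) (X : set S) (D : set T).
Variable f : S -> T -> R.
Hypotheses (mX : measurable X) (mD : measurable D).
Hypothesis mf : measurable_fun (X `*` D) (fun p => f p.1 p.2).
Hypothesis f0 : forall x t, X x -> D t -> (0 <= f x t)%R.
Variable nu : {finite_measure set T -> \bar R}.

Lemma measurable_fun_kernel_section x : X x -> measurable_fun D (f x).
Proof.
move=> Xx _ Y mY.
have := measurable_xsection x (mf (measurableX mX mD) mY).
congr measurable; apply/seteqP; split=> t /=; rewrite /xsection /= inE.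
  by move=> [[]].
by move=> [Dt Yt]; split.
Qed.

Let F := (fun p : S * T => (f p.1 p.2)%:E) \_ (X `*` D).

Let mF : measurable_fun setT F.
Proof.
apply/(measurable_restrict _ _ _) => //; first exact: measurableX.
by rewrite setTI; exact/measurable_EFinP.
Qed.

Let F0 p : 0 <= F p.
Proof. by rewrite /F patchE; case: ifPn => // /[!inE] -[/= ? ?]; rewrite lee_fin f0. Qed.

Let FE : (fun x => \int[nu]_t F (x, t)) = (fun x => \int[nu]_(t in D) (f x t)%:E) \_ X.
Proof.
apply/funext => x; rewrite patchE; case: ifPn => [/[!inE] Xx|/negP Xx].
  rewrite [RHS]integral_mkcond; apply: eq_integral => t _.
  by rewrite /F !patchE in_setX mem_set.
apply: integral0_eq => t _; rewrite /F patchE in_setX /=.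
by rewrite (negPf (introN idP Xx)).
Qed.

Lemma measurable_fun_kernel_integral :
  measurable_fun X (fun x => \int[nu]_(t in D) (f x t)%:E).
Proof.
apply/(measurable_restrictT _ mX); rewrite -FE.
exact: (measurable_fun_fubini_tonelli_F F mF F0).
Qed.

(** The mass of a measure is that of its mixture. *)
Lemma integral_kernel_integral : (forall t, D t -> \int[lam]_(x in X) (f x t)%:E = 1) ->
  \int[lam]_(x in X) \int[nu]_(t in D) (f x t)%:E = nu D.
Proof.
move=> f1; rewrite integral_mkcond -FE (fubini_tonelli F mF F0).
transitivity (\int[nu]_t ((cst 1 \_ D) t)); last first.
  by rewrite -integral_mkcond integral_cst// mul1e.
apply: eq_integral => t _; rewrite patchE; case: ifPn => [/[!inE] Dt|/negP Dt].
  rewrite -(f1 t Dt) [RHS]integral_mkcond; apply: eq_integral => x _.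
  by rewrite /F !patchE in_setX [t \in D]mem_set// andbT.
apply: integral0_eq => x _; rewrite /F patchE in_setX /=.
by rewrite (negPf (introN idP Dt)) andbF.
Qed.

End kernel_mass.

Lemma probability_of_total_mass1 d (T : measurableType d) (R : realType)
    (P : probability T R) (nu : {measure set T -> \bar R}) :
  nu setT = 1%E -> exists Q : probability T R, forall A, Q A = nu A.
Proof.
move=> nu1; exists (mnormalize nu P) => A.
transitivity (mnormalize nu P A) => //; rewrite /mnormalize.
set total := nu _; have -> : total = 1%E by exact: nu1.
by rewrite onee_eq0/= invr1 mule1.
Qed.

(** * Non-identifiability *)

Lemma open_euclidean_ball (R : realType) d (c : 'rV[R]_d) e : open (euclidean_ball c e).
Proof.
rewrite (_ : euclidean_ball c e =
  (fun t : 'rV[R]_d => Num.sqrt (\sum_i (t ord0 i - c ord0 i) ^+ 2)) @^-1`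
    [set x : R | x < e])//.
apply: open_comp; last exact: open_lt.
move=> t _; apply: continuous_comp; last exact: sqrt_continuous.
apply: (@class_C0_continuous _ _ 0); apply: class_C_sum => [|i]; first exact: openT.
rewrite (_ : (fun t => _) = fun t : 'rV[R]_d => (('X - (c ord0 i)%:P) ^+ 2).[t ord0 i]).
  exact: class_C_horner_coord.
by apply/funext => u; rewrite !hornerE.
Qed.

Theorem theorem1 (R : realType) (d1 d2 : nat)
  (X : set 'rV[R]_d1) (mX : measurable X)
  (lam : {sigma_finite_measure set 'rV[R]_d1 -> \bar R})
  (Theta : set 'rV[R]_d2) (hTheta : parameter_space Theta)
  (f : 'rV[R]_d1 -> 'rV[R]_d2 -> R) (hf : is_kernel X lam Theta f)
  (U : set 'rV[R]_d2) (oU : open U) (UTheta : U `<=` Theta°)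
  (r : nat) (L : param_diff_op U r) (pdeL : satisfies_param_pde X lam f L)
  (c : 'rV[R]_d2) (rho : R) (rho_gt0 : 0 < rho)
  (BU : closure (euclidean_ball c rho) `<=` U)
  (ntL : pdo_nontrivial L (euclidean_ball c rho))
  (Gs : probability 'rV[R]_d2 R) (GsTheta : Gs Theta = 1%E)
  (gs : 'rV[R]_d2 -> R) (hgs : has_density Theta Gs gs)
  (m : R) (m_gt0 : 0 < m)
  (gs_ge : {ae rV_lebesgue d2, forall t, euclidean_ball c rho t -> m <= gs t}) :
  exists G : probability 'rV[R]_d2 R,
    [/\ G Theta = 1%E,
        ~ (forall A, measurable A -> G A = Gs A) &
        {ae lam, forall x, X x -> mixture Theta f G x = mixture Theta f Gs x}].
Proof.
have [cTheta _ _] := hTheta; have [mf f0 f1] := hf; have [mgs gs0 GsE] := hgs.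
have mTheta : measurable Theta.
  apply: measurable_closed_rV; apply: compact_closed => //; exact: norm_hausdorff.
have ballU : euclidean_ball c rho `<=` U by apply: subset_trans BU; exact: subset_closure.
have [a [_ [t0 [Bt0 Lat0]]]] := ntL.
have [b [e [h [e0 KB sh [hm hann hneq0]]]]] :=
  exists_pde_annihilator oU (@open_euclidean_ball _ _ c rho) ballU m_gt0 Bt0 Lat0.
have UT : U `<=` Theta by apply: subset_trans UTheta _; exact: interior_subset.
have hT0 t : ~ Theta t -> h t = 0.
  by move=> nT; apply: sh.2 => /KB /ballU /UT.
have ih : (rV_lebesgue d2).-integrable Theta (EFin \o h).
  by apply: (integrableS measurableT) => //; exact: cont_supp_integrable sh.
have gsh0 : {ae rV_lebesgue d2, forall t, Theta t -> 0 <= gs t + h t}.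
  apply: filterS gs_ge => t gst Tt.
  have [/KB /gst mg|/sh.2->] := pselect (cube b e t); last by rewrite addr0 gs0.
  by have := hm t; rewrite ler_norml => /andP[? _]; lra.
have [nu [nuC nuf nuneq]] := exists_perturbed_measure mTheta mgs gs0 GsE ih gsh0.
have mixE : {ae lam, forall x, X x ->
    \int[nu]_(t in Theta) (f x t)%:E = \int[Gs]_(t in Theta) (f x t)%:E}%E.
  apply: filterS pdeL => x /[swap] Xx /(_ Xx) [Cf Lf0].
  have [sfh fh0] := hann _ Cf Lf0.
  have ifh := cont_supp_integrable e0 sfh.
  apply: nuf => [t||| ].
  - exact: f0.
  - exact: (measurable_fun_kernel_section mX mTheta mf).
  - exact: (integrableS measurableT).
  - rewrite integral_mkcond -[LHS]fineK; last first.
      rewrite -integral_mkcond; apply: integrable_fin_num => //.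
      exact: (integrableS measurableT).
    congr EFin; rewrite -[RHS]fh0 /Rintegral; congr fine; apply: eq_integral => t _.
    by rewrite patchE; case: ifPn => // /negP; rewrite inE => /hT0 ->; rewrite mulr0.
have nuT : nu Theta = 1%E.
  rewrite -GsTheta -(integral_kernel_integral mX mTheta mf f0 nu f1).
  rewrite -(integral_kernel_integral mX mTheta mf f0 Gs f1).
  apply: ae_eq_integral => //; exact: measurable_fun_kernel_integral.
have nu1 : nu setT = 1%E.
  transitivity (nu Theta + nu (~` Theta))%E; last by rewrite nuT nuC adde0.
  by have := measureU nu mTheta (measurableC mTheta) (setICr Theta); rewrite setUv.
have [G GE] := probability_of_total_mass1 Gs nu1.
exists G; split; first by rewrite GE.
- move=> GGs; apply: hneq0.
  have : ae_eq (rV_lebesgue d2) Theta (EFin \o h) (cst 0%E).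
    by apply: nuneq => A mA; rewrite -GE GGs.
  apply: filterS => t ht.
  by have [/ht[]|/hT0] := pselect (Theta t).
- apply: filterS mixE => x mixx Xx; apply: etrans (mixx Xx).
  by apply: eq_measure_integral => A _ _; rewrite -GE.
Qed.
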